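(* Let $\bar P\in\mathcal{W}([n],\mathcal{D})$ be reversible, with stationary distribution $\bar\pi=\left(\frac{p_1}{m},\dots,\frac{p_n}{m}\right)$ for $m\in\mathbb{N}$ and $p_1,\dots,p_n\in\mathbb{N}$ with $\sum_{i=1}^np_i=m$. Then there exist a lumping function $\kappa\colon[m]\to[n]$ and a memoryless Markov embedding $L_\star$ (with associated lumping $\kappa$) such that $$L_\star\bar P\in\mathcal{W}_{\mathsf{sym}}([m],\mathcal{E}),\qquad\text{where }\mathcal{E}=\{(y,y')\in[m]^2\colon(\kappa(y),\kappa(y'))\in\mathcal{D}\}.$$
   Context: $[n]=\{1,\dots,n\}$, $n\ge2$, and $([n],\mathcal{D})$ is a strongly connected digraph. For a strongly connected digraph $(\mathcal{Y},\mathcal{E})$, $\mathcal{W}(\mathcal{Y},\mathcal{E})$ is the set of row-stochastic matrices on $\mathcal{Y}$ strictly positive on $\mathcal{E}$ and zero outside; $\mathcal{W}_{\mathsf{sym}}(\mathcal{Y},\mathcal{E})$ is the subset of symmetric matrices. $P$ with stationary distribution $\pi$ is reversible if $\pi(y)P(y,y')=\pi(y')P(y',y)$ for all $y,y'$. A lumping function is a surjective map. Memoryless Markov embedding $L_\star\colon\mathcal{W}(\mathcal{X},\mathcal{D})\to\mathcal{W}(\mathcal{Y},\mathcal{E})$ with associated lumping $\kappa\colon\mathcal{Y}\to\mathcal{X}$: here $\{(\kappa(y),\kappa(y')):(y,y')\in\mathcal{E}\}=\mathcal{D}$, and there is $L\colon\mathcal{Y}\to\mathbb{R}$ such that the matrix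 $\Lambda(y,y')=L(y')$ if $(\kappa(y),\kappa(y'))\in\mathcal{D}$ and $0$ otherwise, is strictly positive on $\mathcal{E}$ and zero outside $\mathcal{E}$, and $(\Lambda(y,y'))_{y'\in\kappa^{-1}(x')}$ is a probability distribution on $\kappa^{-1}(x')$ whenever $(\kappa(y),x')\in\mathcal{D}$; the embedding is $L_\star\bar P(y,y')=\bar P(\kappa(y),\kappa(y'))L(y')$. *)

(* Defs.v *)
From mathcomp Require Import all_boot all_order all_algebra.
From mathcomp Require Import reals.

Set Implicit Arguments.
Unset Strict Implicit.
Unset Printing Implicit Defensive.

Import Order.TTheory GRing.Theory Num.Theory.
Local Open Scope ring_scope.

(* A digraph on the vertex set {0, ..., n-1} is its edge relation
   E : rel 'I_n; loops are allowed. *)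

Definition strongly_connected (n : nat) (E : rel 'I_n) : Prop :=
  forall y y' : 'I_n, connect E y y'.

Definition row_stochastic (R : realType) (n : nat) (P : 'M[R]_n) : Prop :=
  (forall y y', 0 <= P y y') /\ (forall y, \sum_y' P y y' = 1).

Definition supported_exactly (R : realType) (n : nat) (E : rel 'I_n)
    (P : 'M[R]_n) : Prop :=
  (forall y y', E y y' -> 0 < P y y') /\
  (forall y y', ~~ E y y' -> P y y' = 0).

(* W(Y, E) and W_sym(Y, E).  Strong connectedness of E is not part of these
   predicates; it is stated wherever they are used. *)
Definition markovW (R : realType) (n : nat) (E : rel 'I_n) (P : 'M[R]_n) :
    Prop :=
  row_stochastic P /\ supported_exactly E P.

Definition markovW_sym (R : realType) (n : nat) (E : rel 'I_n) (P : 'M[R]_n) :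
    Prop :=
  markovW E P /\ P^T = P.

Definition stationary_distribution (R : realType) (n : nat) (P : 'M[R]_n)
    (pi : 'rV[R]_n) : Prop :=
  [/\ forall y, 0 <= pi 0 y, \sum_y pi 0 y = 1 & pi *m P = pi].

Definition reversible (R : realType) (n : nat) (P : 'M[R]_n)
    (pi : 'rV[R]_n) : Prop :=
  stationary_distribution P pi /\
  (forall y y', pi 0 y * P y y' = pi 0 y' * P y' y).

Definition lumping_function (m n : nat) (kappa : 'I_m -> 'I_n) : Prop :=
  forall x : 'I_n, exists y : 'I_m, kappa y = x.

Definition memoryless_kernel (R : realType) (m n : nat) (D : rel 'I_n)
    (kappa : 'I_m -> 'I_n) (L : 'I_m -> R) : 'M[R]_m :=
  \matrix_(y, y') (if D (kappa y) (kappa y') then L y' else 0).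

(* Lstar, a map W([n], D) -> W([m], E), is represented by a map on all square
   matrices; its values outside W([n], D) are irrelevant. *)
Definition memoryless_embedding (R : realType) (m n : nat)
    (D : rel 'I_n) (E : rel 'I_m) (kappa : 'I_m -> 'I_n)
    (Lstar : 'M[R]_n -> 'M[R]_m) : Prop :=
  [/\ strongly_connected D /\ strongly_connected E,
      lumping_function kappa,
      forall x x' : 'I_n,
        D x x' <-> exists y y' : 'I_m, [/\ E y y', kappa y = x & kappa y' = x'],
      forall P : 'M[R]_n, markovW D P -> markovW E (Lstar P)
    & exists L : 'I_m -> R,
        let Lambda := memoryless_kernel D kappa L in
        [/\ supported_exactly E Lambda,
            forall (y : 'I_m) (x' : 'I_n), D (kappa y) x' ->
              (forall y', kappa y' = x' -> 0 <= Lambda y y') /\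
              \sum_(y' | kappa y' == x') Lambda y y' = 1
          & forall P : 'M[R]_n, markovW D P ->
              forall y y', Lstar P y y' = P (kappa y) (kappa y') * L y']].

(* Main.v *)
Require Import Defs.
From mathcomp Require Import all_boot all_order all_algebra.
From mathcomp Require Import reals.

(* Split each state i into p i copies and spread the mass entering it uniformly
   over them: L y' = 1 / p (kappa y').  The lifted chain is symmetric because
   detailed balance p_x P(x, x') = p_x' P(x', x) says exactly that
   P(x, x') / p_x' = P(x', x) / p_x.  Detailed balance along edges also spreads
   positivity of the p_i over the strongly connected digraph, so that no fiber
   is empty. *)

Set Implicit Arguments.
Unset Strict Implicit.
Unset Printing Implicit Defensive.

Import Order.TTheory GRing.Theory Num.Theory.
Local Open Scope ring_scope.

(** The disjoint union of the ['I_(p i)] has [m] elements; [kappa] is its projection to the index,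
    transported along an enumeration. *)
Lemma exists_map_card_fibers (m n : nat) (p : 'I_n -> nat) :
  (\sum_(i < n) p i)%N = m ->
  exists kappa : 'I_m -> 'I_n, forall x, #|[pred y | kappa y == x]| = p x.
Proof.
move=> hp; pose T := {i : 'I_n & 'I_(p i)}.
have cardT : #|{: T}| = m.
  rewrite card_tagged sumnE big_map big_enum /= -hp.
  by apply: eq_bigr => i _; rewrite card_ord.
pose f (y : 'I_m) : T := enum_val (cast_ord (esym cardT) y).
pose g (t : T) : 'I_m := cast_ord cardT (enum_rank t).
have gK : cancel g f by move=> t; rewrite /f /g cast_ordK enum_rankK.
have fK : cancel f g by move=> y; rewrite /f /g enum_valK cast_ordKV.
exists (fun y => tag (f y)) => x.
pose h (j : 'I_(p x)) : 'I_m := g (Tagged (fun i => 'I_(p i)) j).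
have hK : injective h.
  by move=> j k /(can_inj gK) /eqP; rewrite eq_Tagged => /eqP.
(* The fiber over [x] is the image of the injection [h]. *)
rewrite -[RHS]card_ord -(card_codom hK); apply: eq_card => y.
rewrite inE; apply/eqP/codomP => [|[j ->]]; last by rewrite /h gK.
case ef: (f y) => [i j] /= ix; subst i.
by exists j; rewrite /h -[y]fK ef.
Qed.

Lemma strongly_connected_closed (n : nat) (D : rel 'I_n) (A : pred 'I_n)
    (x y : 'I_n) :
  strongly_connected D -> (forall u v, D u v -> A u -> A v) -> A x -> A y.
Proof.
move=> hD hA; have /connectP[s + ->] := hD x y.
by elim: s x => //= z s IHs x /andP[Dxz sP] /(hA _ _ Dxz); apply: IHs.
Qed.

(* Two points of one fiber are joined through a closed walk of positive length
   in D, hence the existence of out-neighbours. *)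
Lemma strongly_connected_preimage (m n : nat) (D : rel 'I_n)
    (kappa : 'I_m -> 'I_n) :
  strongly_connected D -> (forall x, exists z, D x z) ->
  lumping_function kappa ->
  strongly_connected (fun y y' => D (kappa y) (kappa y')).
Proof.
move=> hD hout hk y y'.
(* Inner vertices of the walk lift to arbitrary preimages; [rcons] isolates the endpoint, which must
   lift to [y'] itself. *)
have lift s : forall w, path D (kappa w) (rcons s (kappa y')) ->
    connect (fun y y' => D (kappa y) (kappa y')) w y'.
  elim: s => [|z s IHs] w /=; first by rewrite andbT => Dw; apply: connect1.
  have [v <-] := hk z; case/andP=> Dwv /IHs; apply: connect_trans.
  exact: connect1.
have [z Dyz] := hout (kappa y).
have /connectP[s sP e] := hD z (kappa y').
by apply: (lift (belast z s)); rewrite e -lastI /= Dyz.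
Qed.

Lemma markovW_out_neighbour (R : realType) (n : nat) (D : rel 'I_n)
    (P : 'M[R]_n) (x : 'I_n) :
  markovW D P -> exists z, D x z.
Proof.
case=> [[_ P1] [_ P0]].
case: (boolP [exists z, D x z]) => [/existsP //|/existsPn noD].
have /eqP := P1 x; rewrite big1 => [|z _]; last exact/P0/noD.
by rewrite eq_sym oner_eq0.
Qed.

Lemma reversible_support_closed (R : realType) (n : nat) (D : rel 'I_n)
    (P : 'M[R]_n) (pi : 'rV[R]_n) (u v : 'I_n) :
  markovW D P -> reversible P pi -> D u v -> 0 < pi 0 u -> 0 < pi 0 v.
Proof.
move=> [_ [Ppos _]] [[pi_ge0 _ _] bal] Duv pu.
rewrite lt0r pi_ge0 andbT; apply/eqP => pv0.
by have := mulr_gt0 pu (Ppos _ _ Duv); rewrite bal pv0 mul0r ltxx.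
Qed.

(** Some entry is positive since the total is 1, and positivity then travels along the edges of
    [D]. *)
Lemma reversible_gt0 (R : realType) (n : nat) (D : rel 'I_n)
    (P : 'M[R]_n) (pi : 'rV[R]_n) (x : 'I_n) :
  strongly_connected D -> markovW D P -> reversible P pi -> 0 < pi 0 x.
Proof.
move=> hD hP hrev; have [[pi_ge0 pi1 _] _] := hrev.
have [z pz] : exists z, 0 < pi 0 z.
  case: (boolP [exists z, 0 < pi 0 z]) => [/existsP //|/existsPn npos].
  have /eqP := pi1; rewrite big1 => [|z _]; first by rewrite eq_sym oner_eq0.
  by apply/eqP; move: (npos z); rewrite lt0r pi_ge0 andbT negbK.
apply: (@strongly_connected_closed n D (fun y => 0 < pi 0 y) z x hD _ pz).
by move=> u v; apply: reversible_support_closed hP hrev.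
Qed.

Lemma markovW_lift (R : realType) (m n : nat) (D : rel 'I_n)
    (kappa : 'I_m -> 'I_n) (L : 'I_m -> R) (P : 'M[R]_n) :
  (forall y, 0 < L y) -> (forall x, \sum_(y | kappa y == x) L y = 1) ->
  markovW D P ->
  markovW (fun y y' => D (kappa y) (kappa y'))
    (\matrix_(y, y') (P (kappa y) (kappa y') * L y')).
Proof.
move=> L_gt0 L1 [[P_ge0 P1] [Ppos P0]]; split; split=> y.
- by move=> y'; rewrite mxE mulr_ge0 ?P_ge0 ?ltW.
(* Grouped by fibers, the row sum becomes a row sum of [P], because [L] has mass 1 on each fiber. *)
- rewrite -[RHS](P1 (kappa y)) (partition_big kappa xpredT) //=.
  apply: eq_bigr => x _; rewrite -[RHS]mulr1 -(L1 x) mulr_sumr.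
  by apply: eq_bigr => y' /eqP <-; rewrite mxE.
- by move=> y' Dyy'; rewrite mxE mulr_gt0 ?Ppos.
- by move=> y' /P0 Dyy'; rewrite mxE Dyy' mul0r.
Qed.

(** Any positive weights of mass 1 on each fiber will do here; the uniform choice matters only for
    symmetry. *)
Lemma memoryless_embedding_lift (R : realType) (m n : nat) (D : rel 'I_n)
    (kappa : 'I_m -> 'I_n) (L : 'I_m -> R) :
  strongly_connected D -> (forall x, exists z, D x z) ->
  lumping_function kappa ->
  (forall y, 0 < L y) -> (forall x, \sum_(y | kappa y == x) L y = 1) ->
  memoryless_embedding D (fun y y' => D (kappa y) (kappa y')) kappa
    (fun P => \matrix_(y, y') (P (kappa y) (kappa y') * L y')).
Proof.
move=> hD hout hk L_gt0 L1; split=> //.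
- by split=> //; apply: strongly_connected_preimage.
- move=> x x'; split=> [Dxx'|[y [y' [+ <- <-]]] //].
  have [y yx] := hk x; have [y' yx'] := hk x'.
  by exists y, y'; rewrite yx yx'.
- by move=> P; apply: markovW_lift.
exists L; split=> [|y x' Dyx'|P _ y y']; last by rewrite mxE.
- by split=> y y' Dyy'; rewrite mxE ?Dyy' // (negbTE Dyy').
- split=> [y' e|]; first by rewrite mxE e Dyx' ltW.
  by rewrite -[RHS](L1 x'); apply: eq_bigr => y' /eqP e; rewrite mxE e Dyx'.
Qed.

Theorem corollary4p3 (R : realType) (n : nat) (hn : (2 <= n)%N)
    (D : rel 'I_n) (hD : strongly_connected D)
    (Pbar : 'M[R]_n) (hP : markovW D Pbar)
    (m : nat) (hm : (0 < m)%N) (p : 'I_n -> nat)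
    (hp : (\sum_(i < n) p i)%N = m)
    (hrev : reversible Pbar (\row_(i < n) ((p i)%:R / m%:R))) :
  exists (kappa : 'I_m -> 'I_n) (Lstar : 'M[R]_n -> 'M[R]_m),
    let E : rel 'I_m := fun y y' => D (kappa y) (kappa y') in
    [/\ lumping_function kappa,
        memoryless_embedding D E kappa Lstar
      & markovW_sym E (Lstar Pbar)].
Proof.
have m_gt0 : 0 < m%:R :> R by rewrite ltr0n.
(* This makes the fibers nonempty and keeps the inverse in [L] away from the default value at 0. *)
have p_gt0 x : 0 < (p x)%:R :> R.
  by have := reversible_gt0 x hD hP hrev; rewrite mxE pmulr_lgt0 ?invr_gt0.
have [kappa fibers] := exists_map_card_fibers hp.
pose L (y : 'I_m) : R := ((p (kappa y))%:R)^-1.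
have L_gt0 y : 0 < L y by rewrite invr_gt0.
have L1 x : \sum_(y | kappa y == x) L y = 1.
  rewrite (eq_bigr (fun=> ((p x)%:R)^-1)) => [|y /eqP <- //].
  by rewrite sumr_const fibers -[LHS]mulr_natr mulVf ?gt_eqF.
have hk : lumping_function kappa.
  move=> x; have : (0 < #|[pred y | kappa y == x]|)%N.
    by rewrite fibers -(ltr0n R).
  by case/card_gt0P=> y /eqP; exists y.
exists kappa, (fun P => \matrix_(y, y') (P (kappa y) (kappa y') * L y')).
split=> //; first apply: memoryless_embedding_lift => //.
  by move=> x; apply: markovW_out_neighbour hP.
split; first exact: markovW_lift.
apply/matrixP => y y'; rewrite !mxE /L.
have [_ /(_ (kappa y) (kappa y'))] := hrev; rewrite !mxE.
(* Cancelling [1 / m] in detailed balance leaves exactly the cross-multiplied form of the symmetry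
   goal. *)
rewrite ![_ / m%:R * _]mulrAC => /(mulIf (invr_neq0 (lt0r_neq0 m_gt0))) bal.
apply/eqP; rewrite eqr_div ?lt0r_neq0 //; apply/eqP.
by rewrite mulrC -bal mulrC.
Qed.
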